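(* Let $(X,\|\cdot\|)$ be a complex Banach space. (i) Let $p\in\mathcal{P}([0,1])$. Then $AAS^{p(x)}(\mathbb{R}:X)\hookrightarrow AAS^{1}(\mathbb{R}:X)$ and $AAAS^{p(x)}([0,\infty):X)\hookrightarrow AAAS^{1}([0,\infty):X)$. (ii) Let $p\in D_{+}([0,1])$, so that $1\le p^{-}\le p(x)\le p^{+}<\infty$ for a.e. $x\in[0,1]$. Then $AAS^{p^{+}}(\mathbb{R}:X)\hookrightarrow AAS^{p(x)}(\mathbb{R}:X)\hookrightarrow AAS^{p^{-}}(\mathbb{R}:X)$ and $AAAS^{p^{+}}([0,\infty):X)\hookrightarrow AAAS^{p(x)}([0,\infty):X)\hookrightarrow AAAS^{p^{-}}([0,\infty):X)$. (iii) If $p,q\in\mathcal{P}([0,1])$ and $p\le q$ a.e. on $[0,1]$, then $AAS^{q(x)}(\mathbb{R}:X)\hookrightarrow AAS^{p(x)}(\mathbb{R}:X)$ and $AAAS^{q(x)}([0,\infty):X)\hookrightarrow AAAS^{p(x)}([0,\infty):X)$.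
   Context: The symbol $\hookrightarrow$ denotes a continuous embedding (inclusion) between normed spaces. Variable exponent spaces. $\mathcal{P}([0,1])$ is the set of all Lebesgue measurable functions $p:[0,1]\to[1,\infty]$. For measurable $p$, $p^{-}:=\operatorname{essinf}_{x\in[0,1]}p(x)$ and $p^{+}:=\operatorname{esssup}_{x\in[0,1]}p(x)$; $D_{+}([0,1])$ is the set of measurable real-valued $p$ on $[0,1]$ with $1\le p^{-}\le p(x)\le p^{+}<\infty$ for a.e. $x\in[0,1]$. For $p\in\mathcal{P}([0,1])$ and $t\ge 0$ put $\varphi_{p(x)}(t)=t^{p(x)}$ if $p(x)<\infty$; if $p(x)=\infty$, put $\varphi_{p(x)}(t)=0$ for $0\le t\le 1$ and $\varphi_{p(x)}(t)=\infty$ for $t>1$. For measurable $u:[0,1]\to X$ let $\rho(u)=\int_0^1\varphi_{p(x)}(\|u(x)\|)\,dx$. The space $L^{p(x)}([0,1]:X)$ consists of all measurable $u:[0,1]\to X$ with $\rho(\lambda u)<\infty$ for some $\lambda>0$ (functions equal a.e. identified), with the Luxemburg norm $\|u\|_{L^{p(x)}([0,1]:X)}=\inf\{\lambda>0:\rho(u/\lambda)\le 1\}$; it is a Banach space, equal to the usual $L^p$ when $p(x)\equiv p$ is constant. Let $I=\mathbb{R}$ or $I=[0,\infty)$. $L_S^{p(x)}(I:X)$ is the space of measurable $f:I\to X$ such that $f(\cdot+t)\in L^{p(x)}([0,1]:X)$ for all $t\in I$ and $\|f\|_{S^{p(x)}}:=\sup_{t\in I}\|f(\cdot+t)\|_{L^{p(x)}([0,1]:X)}<\infty$.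 $AAS^{p(x)}(\mathbb{R}:X)$ is the space of $S^{p(x)}$-almost automorphic functions: those $f\in L_S^{p(x)}(\mathbb{R}:X)$ such that for every real sequence $(a_n)$ there exist a subsequence $(a_{n_k})$ and $g\in L_S^{p(x)}(\mathbb{R}:X)$ such that, for each $t\in\mathbb{R}$, $\lim_{k\to\infty}\|f(a_{n_k}+\cdot+t)-g(\cdot+t)\|_{L^{p(x)}([0,1]:X)}=0$ and $\lim_{k\to\infty}\|g(\cdot-a_{n_k}+t)-f(\cdot+t)\|_{L^{p(x)}([0,1]:X)}=0$. It is normed by $\|\cdot\|_{S^{p(x)}}$. $AAAS^{p(x)}([0,\infty):X)$ is the space of asymptotically $S^{p(x)}$-almost automorphic functions: those $f\in L_S^{p(x)}([0,\infty):X)$ for which there exist $g\in AAS^{p(x)}(\mathbb{R}:X)$ and $w\in L_S^{p(x)}([0,\infty):X)$ with $f(t)=g(t)+w(t)$ for $t\ge 0$ and $\hat w\in C_0([0,\infty):L^{p(x)}([0,1]:X))$, where $\hat w(t):=w(t+\cdot)$ and $C_0([0,\infty):Z)$ denotes continuous $Z$-valued functions tending to $0$ at $+\infty$. It is normed by $\|\cdot\|_{S^{p(x)}}$. For a constant exponent $r\in[1,\infty)$, $AAS^{r}$ and $AAAS^{r}$ denote these spaces with $p(x)\equiv r$. *)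

(* Defs.v *)
From HB Require Import structures.
From mathcomp Require Import all_boot all_order all_algebra.
From mathcomp Require Import all_classical all_reals all_analysis.
From mathcomp Require Import measurable_realfun ess_sup_inf complex.

Set Implicit Arguments.
Unset Strict Implicit.
Unset Printing Implicit Defensive.

Import Order.TTheory GRing.Theory Num.Theory.
Import numFieldNormedType.Exports.

Local Open Scope classical_set_scope.
Local Open Scope ring_scope.
Local Open Scope complex_scope.

(* The real line with the sigma-algebra of Lebesgue (not only Borel) measurable
   sets, i.e. the domain of [completed_lebesgue_measure]. *)
Definition lebesgueR (R : realType) : measurableType _ :=
  caratheodory_type ((wlength (@idfun R))^*)%mu.

Definition leb (R : realType) : {measure set (lebesgueR R) -> \bar R} :=
  @completed_lebesgue_measure R.

Definition itv01 (R : realType) : set (lebesgueR R) := [set` `[0%R, 1%R]].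

Lemma lebesgueR_itv (R : realType) (i : interval R) :
  measurable ([set` i] : set (lebesgueR R)).
Proof. by apply: sub_caratheodory; exact: measurable_itv. Qed.

Definition leb01 (R : realType) : {measure set (lebesgueR R) -> \bar R} :=
  mrestr (@leb R) (@lebesgueR_itv R `[0%R, 1%R]).

(* Functions on [0,1] (resp. on I) are total functions on R
   of which only the values on [0,1] (resp. on I) matter. *)

Definition var_exponent (R : realType) (p : R -> \bar R) : Prop :=
  measurable_fun (@itv01 R) (p : lebesgueR R -> \bar R) /\
  (forall x, itv01 x -> (1 <= p x)%E).

Definition pminus (R : realType) (p : R -> \bar R) : \bar R :=
  ess_inf (@leb01 R) p.

Definition pplus (R : realType) (p : R -> \bar R) : \bar R :=
  ess_sup (@leb01 R) p.

Definition Dplus (R : realType) (p : R -> R) : Prop :=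
  [/\ measurable_fun (@itv01 R) (p : lebesgueR R -> measurableTypeR R),
      (1 <= pminus (EFin \o p))%E,
      {ae @leb R, forall x, itv01 x ->
         (pminus (EFin \o p) <= (p x)%:E <= pplus (EFin \o p))%E} &
      (pplus (EFin \o p) < +oo)%E].

(* The value at -oo is irrelevant, exponents being >= 1. *)
Definition phi (R : realType) (e : \bar R) (t : R) : \bar R :=
  match e with
  | r%:E => (t `^ r)%:E
  | +oo%E => if t <= 1 then 0%E else +oo%E
  | -oo%E => 0%E
  end.

Section Banach.
Context {R : realType} {X : completeNormedModType R[i]}.
Implicit Types (p : R -> \bar R) (u f g w : R -> X) (D I : set R) (r : R).

(* The norm of X takes its values in R[i]; it is real, and we take it in R. *)
Definition rnorm (x : X) : R := complex.Re `|x|.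

Definition simple_on D u : Prop :=
  finite_set (u @` D) /\
  (forall y : X, measurable (D `&` u @^-1` [set y] : set (lebesgueR R))).

(* Measurability of Banach-valued functions is strong (Bochner) measurability. *)
Definition Xmeasurable D u : Prop :=
  exists s : nat -> R -> X, (forall n, simple_on D (s n)) /\
    {ae @leb R, forall x, D x -> s n x @[n --> \oo] --> u x}.

Definition modular p u : \bar R :=
  (\int[@leb R]_(x in @itv01 R) phi (p x) (rnorm (u x)))%E.

Definition Lpx p : set (R -> X) :=
  [set u | Xmeasurable (@itv01 R) u /\
     exists2 r, 0 < r & (modular p (r%:C \*: u) < +oo)%E].

(* Luxemburg norm; +oo when no r qualifies. *)
Definition Lpx_norm p u : \bar R :=
  ereal_inf [set r%:E | r in
    [set r : R | 0 < r /\ (modular p ((r^-1)%:C \*: u) <= 1)%E]].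

Definition Spx_norm p I f : \bar R :=
  ereal_sup [set Lpx_norm p (fun x => f (x + t)) | t in I].

Definition LSpx p I : set (R -> X) :=
  [set f | [/\ Xmeasurable I f,
               forall t, I t -> Lpx p (fun x => f (x + t)) &
               (Spx_norm p I f < +oo)%E]].

Definition AASpx p : set (R -> X) :=
  [set f | LSpx p setT f /\
    forall a : nat -> R,
      exists k : nat -> nat, {homo k : m n / (m < n)%N} /\
      exists g, LSpx p setT g /\
        forall t : R,
          (Lpx_norm p (fun x => f (a (k n) + x + t) - g (x + t))
             @[n --> \oo] --> 0%E) /\
          (Lpx_norm p (fun x => g (x - a (k n) + t) - f (x + t))
             @[n --> \oo] --> 0%E)].

Definition halfline : set R := [set` `[0%R, +oo[].

(* t |-> w(t + .) belongs to C_0([0, +oo[ : L^p(x)([0,1] : X)) *)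
Definition C0_hat p w : Prop :=
  [/\ forall t, halfline t -> Lpx p (fun x => w (t + x)),
      forall t, halfline t ->
        Lpx_norm p (fun x => w (s + x) - w (t + x))
          @[s --> within halfline (nbhs t)] --> 0%E &
      Lpx_norm p (fun x => w (t + x)) @[t --> +oo] --> 0%E].

Definition AAASpx p : set (R -> X) :=
  [set f | LSpx p halfline f /\
    exists g w, [/\ AASpx p g, LSpx p halfline w,
                    forall t, halfline t -> f t = g t + w t & C0_hat p w]].

End Banach.

(* Continuous inclusion of the normed space (E, nE) into (F, nF), the inclusion
   being linear and hence continuous iff bounded. The spaces are given by their
   representatives: two functions represent the same element iff they agree
   a.e. on the common domain, whatever the exponent, so that an inclusion of the
   sets of representatives is an (injective) inclusion of the quotients. *)
Definition embeds (R : realType) (V : Type) (E : set V) (nE : V -> \bar R)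
    (F : set V) (nF : V -> \bar R) : Prop :=
  E `<=` F /\
  exists2 C : R, 0 < C & forall f, E f -> (nF f <= C%:E * nE f)%E.

Definition embeds_AAS (R : realType) (X : completeNormedModType R[i])
    (p q : R -> \bar R) : Prop :=
  embeds (@AASpx R X p) (Spx_norm p setT) (@AASpx R X q) (Spx_norm q setT).

Definition embeds_AAAS (R : realType) (X : completeNormedModType R[i])
    (p q : R -> \bar R) : Prop :=
  embeds (@AAASpx R X p) (Spx_norm p halfline)
         (@AAASpx R X q) (Spx_norm q halfline).

(* Main.v *)
Require Import Defs.
From mathcomp Require Import all_boot all_order all_algebra.
From mathcomp Require Import all_classical all_reals all_analysis.
From mathcomp Require Import measurable_realfun ess_sup_inf complex.

(** Every inclusion in the theorem has the form: if [1 <= p <= q] a.e. on [0,1],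
    then the space with exponent [q] embeds into the space with exponent [p].
    The exponents compared are [1 <= p], [p^- <= p <= p^+] and [p <= q].

    The heart of the matter is the pointwise estimate
      phi_p(c t) <= c phi_p(t) <= c (1 + phi_q(t))   for 0 < c <= 1,
    whose first half is convexity of [phi_p] together with [phi_p(0) = 0], and whose second half holds because [phi_p(t) <= 1] when [t <= 1] and
    [phi_p(t) <= phi_q(t)] when [t > 1]. Integrating over [0,1], which has
    measure 1, gives [rho_p(c u) <= c (1 + rho_q(u))] ([modular_le]). With
    [c = 1] this shows that finiteness of the modular passes from [q] to [p];
    with [c = 1/2] it shows that [rho_q(u) <= 1] implies [rho_p(u/2) <= 1],
    so that the Luxemburg norms satisfy [|u|_p <= 2 |u|_q] ([Lpx_norm_le]).

    All the rest is formal. The Stepanov norm is a supremum of Luxemburg norms,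
    so it inherits the factor 2; almost automorphy and the [C_0] condition say
    that certain Luxemburg norms tend to 0, which the same inequality transfers
    with the same subsequences, limit functions and decompositions.

    The integral of a nonnegative function is the supremum of the integrals of
    the simple functions below it. The integral inequality
    ([ae_le_integral_affine]) can be checked on those simple functions, so the
    estimates hold for an arbitrary function [u], measurable or not. *)

Set Implicit Arguments.
Unset Strict Implicit.
Unset Printing Implicit Defensive.

Import Order.TTheory GRing.Theory Num.Theory.
Import numFieldNormedType.Exports.

Local Open Scope classical_set_scope.
Local Open Scope ring_scope.

(** * Integrals of functions that need not be measurable *)

Section IntegralComparison.
Context {d : measure_display} {T : measurableType d} {R : realType}.
Variable mu : {measure set T -> \bar R}.
Import HBNNSimple.
Local Open Scope ereal_scope.

Lemma le_integral_pointwise (f g : T -> \bar R) :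
  (forall x, 0 <= f x) -> (forall x, f x <= g x) ->
  \int[mu]_x f x <= \int[mu]_x g x.
Proof.
move=> f0 fg; have g0 x : 0 <= g x by exact: le_trans (fg x).
rewrite !ge0_integralTE//; apply: ereal_sup_le => _ [h hf <-].
by exists h => // x; exact: le_trans (fg x).
Qed.

(** Addition under the integral sign fails for arbitrary functions, but here one
    summand is constant. If a simple [h] lies below [f], then off a null set the
    positive part of [h / c - 1] is a measurable function below [g], and
    [h <= c (1 + (h / c - 1)^+)] involves measurable functions only. *)
Lemma ae_le_integral_affine (D : set T) (f g : T -> \bar R) (c : R) :
  measurable D -> (0 < c)%R ->
  (forall x, 0 <= f x) -> (forall x, 0 <= g x) ->
  {ae mu, forall x, D x -> f x <= c%:E * (1 + g x)} ->
  \int[mu]_(x in D) f x <= c%:E * (mu D + \int[mu]_(x in D) g x).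
Proof.
move=> mD c0 f0 g0 [N [mN muN0 fgN]].
rewrite integral_mkcond ge0_integralTE; last by move=> x; exact: erestrict_ge0.
apply: ge_ereal_sup => _ [h hf <-]; rewrite -integralT_nnsfun.
have h_ge0 x : (0 <= h x)%R by [].
have -> : \int[mu]_x (h x)%:E = \int[mu]_(x in D) (h x)%:E.
  rewrite [RHS]integral_mkcond; apply: eq_integral => x _.
  rewrite patchE; case: ifPn => // xD.
  by have := hf x; rewrite patchE (negbTE xD) lee_fin => h0; congr EFin;
    apply/eqP; rewrite eq_le h0 h_ge0.
have mh : measurable_fun setT h by exact: measurable_funP.
(* Only the measurable h can be cut off at N: f and g stay untouched. *)
rewrite (ge0_negligible_integral mN mD)//=; last 2 first.
- exact/measurable_EFinP/measurable_funTS.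
- by move=> x _; rewrite lee_fin.
pose k x := Num.max (c^-1 * h x - 1)%R 0%R.
have mk : measurable_fun setT k.
  apply: measurable_maxr => //; apply: measurable_funB => //.
  exact: measurable_funM.
have mDN : measurable (D `\` N) by exact: measurableD.
have k0 x : 0 <= (k x)%:E by rewrite lee_fin le_max lexx orbT.
have mkE : measurable_fun (D `\` N) (fun x => (k x)%:E).
  exact/measurable_EFinP/measurable_funTS.
apply: (@le_trans _ _ (\int[mu]_(x in D `\` N) (c%:E * (1 + (k x)%:E)))).
  apply: ge0_le_integral => //.
  - by move=> x _; rewrite lee_fin.
  - exact/measurable_EFinP/measurable_funTS.
  - exact: (measurable_funeM _ (emeasurable_funD (measurable_cst _) mkE)).
  - move=> x _; rewrite -EFinD -EFinM lee_fin.
    rewrite -ler_pdivrMl// -lerBlDl.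
    by rewrite le_max lexx.
rewrite ge0_integralZl//; last 3 first.
- exact: emeasurable_funD (measurable_cst _) mkE.
- by move=> x _; rewrite adde_ge0.
- by rewrite lee_fin ltW.
rewrite ge0_integralD// integral_cst// mul1e.
rewrite lee_pmul2l// leeD//.
  by apply: le_measure; rewrite ?inE//; exact: subDsetl.
rewrite integral_mkcond [leRHS]integral_mkcond.
apply: le_integral_pointwise => x; first exact: erestrict_ge0.
rewrite !patchE; case: ifPn; last by case: ifP.
rewrite inE => -[Dx Nx]; rewrite mem_set//.
have fgx : f x <= c%:E * (1 + g x).
  by apply: contra_notP Nx => fgx; apply: fgN => /(_ Dx).
have := hf x; rewrite patchE mem_set// => /le_trans/(_ fgx).
case: (g x) (g0 x) => [r|_ _|]//; last by rewrite leey.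
rewrite -EFinD -EFinM !lee_fin => r0.
by rewrite -ler_pdivrMl// -lerBlDl ge_max r0 andbT.
Qed.

End IntegralComparison.

(** * Pointwise estimates *)

Section Phi.
Context {R : realType}.
Implicit Types (p q : \bar R) (t c : R).
Local Open Scope ereal_scope.

Lemma phi_ge0 p t : 0 <= phi p t.
Proof. by case: p => [r| |]//=; [rewrite lee_fin powR_ge0|case: ifP]. Qed.

Lemma phi_le p q t : 1 <= p -> p <= q -> (0 <= t)%R ->
  phi p t <= 1 + phi q t.
Proof.
move=> p1 pq t0; have [t1|t1] := leP t 1%R.
  (* phi_q(t) may be smaller than phi_p(t) here, hence the summand 1. *)
  suff pt1 : phi p t <= 1 by rewrite (le_trans pt1)// leeDl// phi_ge0.
  case: p p1 {pq} => [r| |]//=; last by rewrite t1.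
  rewrite !lee_fin => r1; have [->|tn0] := eqVneq t 0%R.
    by rewrite powR0// gt_eqF// (lt_le_trans _ r1).
  by rewrite (le_trans _ t1)// ge1r_powR// lt0r tn0 t0.
apply: (@le_trans _ _ (phi q t)); last by rewrite leeDr.
case: q pq => [s| |]/=; last 1 first.
- by rewrite leeNy_eq => /eqP pE; rewrite pE in p1.
- by case: p p1 => [r| |]//= _; rewrite !lee_fin => rs; rewrite ler_powR// ltW.
- by move=> _; rewrite (lt_geF t1) leey.
Qed.

Lemma phi_scale p c t : 1 <= p -> (0 < c <= 1)%R -> (0 <= t)%R ->
  phi p (c * t) <= c%:E * phi p t.
Proof.
move=> + /andP[c0 c1] t0; case: p => [r| |]//=.
  rewrite -EFinM !lee_fin => r1; rewrite powRM ?(ltW c0)// ler_wpM2r ?powR_ge0//.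
  by rewrite ge1r_powR ?c0.
have [t1 _|t1 _] := leP t 1%R; first by rewrite mulr_ile1// ?mule0// ltW.
by rewrite gt0_muley ?lte_fin// leey.
Qed.

End Phi.

(** * Comparison of two exponents *)

Section Exponents.
Context {R : realType} {X : completeNormedModType R[i]}.
Implicit Types (p q : R -> \bar R) (u f w : R -> X).

Lemma rnorm_ge0 (x : X) : 0 <= rnorm x.
Proof. by have := normr_ge0 x; rewrite lecE => /andP[]. Qed.

Lemma rnormZ (c : R) (x : X) : 0 <= c -> rnorm (c%:C%C *: x) = c * rnorm x.
Proof.
move=> c0; rewrite /rnorm normrZ ger0_norm ?lecR//.
by case: `|x| => a b /=; rewrite mul0r subr0.
Qed.

Lemma leb_itv01 : (@leb R) (@itv01 R) = 1%E.
Proof.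
have := @lebesgue_measure_itv R `[0%R, 1%R].
by rewrite /= lte_fin ltr01 sube0.
Qed.

(** Both inequalities are a.e. because [p^-] and [p^+] bound [p] only a.e.; the
    first one makes [phi_p] convex. *)
Definition le_exponent p q : Prop :=
  {ae @leb R, forall x, itv01 x -> (1 <= p x)%E /\ (p x <= q x)%E}.

Section Comparison.
Variables (p q : R -> \bar R).
Hypothesis pq : le_exponent p q.

(** The factor [c] in front of the whole right-hand side is what lets a small
    multiple of [u] absorb the additive constant. *)
Lemma modular_le (c : R) u : 0 < c <= 1 ->
  (modular p (c%:C%C \*: u) <= c%:E * (1 + modular q u))%E.
Proof.
move=> c01; have /andP[c0 c1] := c01; rewrite -leb_itv01.
apply: ae_le_integral_affine => //.
- exact: lebesgueR_itv.
- by move=> x; exact: phi_ge0.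
- by move=> x; exact: phi_ge0.
apply: filterS pq => x + x01 => /(_ x01)[p1 pqx].
rewrite /= rnormZ ?(ltW c0)//.
apply: (le_trans (phi_scale p1 c01 (rnorm_ge0 (u x)))).
by rewrite lee_pmul2l// phi_le// rnorm_ge0.
Qed.

Lemma Lpx_sub : Lpx q `<=` @Lpx R X p.
Proof.
move=> u [um [r r0 fin]]; split=> //; exists r => //.
have := @modular_le 1 (r%:C%C \*: u).
rewrite lexx ltr01 => /(_ isT); rewrite mul1e.
have -> : 1%:C%C \*: (r%:C%C \*: u) = r%:C%C \*: u.
  by apply/funext => x /=; rewrite scale1r.
by move=> /le_lt_trans; apply; rewrite lte_add_pinfty// ltry.
Qed.

(** If [r] is admissible for the exponent [q], then [2 r] is admissible for [p]:
    [rho_p(u / (2 r)) <= (1 + rho_q(u / r)) / 2 <= 1]. *)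
Lemma Lpx_norm_le u : (Lpx_norm p u <= 2%:E * Lpx_norm q u)%E.
Proof.
rewrite /Lpx_norm -ereal_inf_pZl//.
apply: le_ereal_inf_tmp => _ [_ [r [r0 m1] <-] <-].
apply: ereal_inf_lbound; exists (2 * r); last by rewrite EFinM.
split; first by rewrite mulr_gt0.
have -> : ((2 * r)^-1)%:C%C \*: u = (2^-1)%:C%C \*: ((r^-1)%:C%C \*: u).
  by apply/funext => x /=; rewrite scalerA -rmorphM /= invfM.
apply: le_trans (modular_le _ _) _.
  by rewrite invr_gt0 ltr0n invf_le1// ler1n.
apply: (@le_trans _ _ ((2^-1)%:E * (1 + 1)))%E.
  by rewrite lee_pmul2l ?lte_fin ?invr_gt0// leeD2l.
by rewrite -EFinD -EFinM lee_fin mulVf.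
Qed.

Lemma Lpx_norm_ge0 (e : R -> \bar R) u : (0 <= Lpx_norm e u)%E.
Proof.
by apply: le_ereal_inf_tmp => _ [r [r0 _] <-]; rewrite lee_fin ltW.
Qed.

Lemma Lpx_norm_cvg0 (I : Type) (F : set_system I) (u : I -> R -> X) :
  Filter F -> Lpx_norm q (u i) @[i --> F] --> 0%E ->
  Lpx_norm p (u i) @[i --> F] --> 0%E.
Proof.
move=> FF uq.
apply: (@squeeze_cvge _ _ _ _ (cst 0%E) _ (fun i => 2%:E * Lpx_norm q (u i))%E).
- by apply: nearW => i; rewrite Lpx_norm_ge0 Lpx_norm_le.
- exact: cvg_cst.
- by rewrite -[X in _ --> X](mule0 2%:E); exact: cvgeZl.
Qed.

Lemma Spx_norm_le I f : (Spx_norm p I f <= 2%:E * Spx_norm q I f)%E.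
Proof.
rewrite /Spx_norm -ereal_sup_pZl//.
apply: ge_ereal_sup => _ [t It <-]; apply: le_ereal_sup_tmp.
exists (2%:E * Lpx_norm q (fun x => f (x + t)%R))%E; last exact: Lpx_norm_le.
by exists (Lpx_norm q (fun x => f (x + t)%R)) => //; exists t.
Qed.

Lemma LSpx_sub I : LSpx q I `<=` @LSpx R X p I.
Proof.
move=> f [mf fL fS]; split=> //.
- by move=> t It; apply: Lpx_sub; exact: fL.
- apply: le_lt_trans (Spx_norm_le _ _) _.
  by apply: lte_mul_pinfty => //; rewrite lee_fin.
Qed.

Lemma AASpx_sub : AASpx q `<=` @AASpx R X p.
Proof.
move=> f [fL fa]; split; first exact: LSpx_sub.
move=> a; have [k [k_mono [g [gL fg]]]] := fa a.
exists k; split=> //; exists g; split; first exact: LSpx_sub.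
by move=> t; have [? ?] := fg t; split; exact: Lpx_norm_cvg0.
Qed.

Lemma C0_hat_sub w : C0_hat q w -> C0_hat p w.
Proof.
move=> [wL wc w0]; split.
- by move=> t It; apply: Lpx_sub; exact: wL.
- by move=> t It; apply: Lpx_norm_cvg0; exact: wc.
- exact: Lpx_norm_cvg0.
Qed.

Lemma AAASpx_sub : AAASpx q `<=` @AAASpx R X p.
Proof.
move=> f [fL [g [w [gA wL fgw w0]]]]; split; first exact: LSpx_sub.
by exists g, w; split=> //; [exact: AASpx_sub|exact: LSpx_sub|exact: C0_hat_sub].
Qed.

(** The common form of all the embeddings, with embedding constant 2. *)
Lemma embeds_le_exponent : embeds_AAS X q p /\ embeds_AAAS X q p.
Proof.
split; split.
- exact: AASpx_sub.
- by exists 2 => // f _; exact: Spx_norm_le.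
- exact: AAASpx_sub.
- by exists 2 => // f _; exact: Spx_norm_le.
Qed.

End Comparison.
End Exponents.

Theorem theorem3p7 (R : realType) (X : completeNormedModType R[i]) :
  (forall p : R -> \bar R, var_exponent p ->
     embeds_AAS X p (cst 1%E) /\ embeds_AAAS X p (cst 1%E)) /\
  (forall p : R -> R, Dplus p ->
     let pm := cst (pminus (EFin \o p)) : R -> \bar R in
     let pp := cst (pplus (EFin \o p)) : R -> \bar R in
     (embeds_AAS X pp (EFin \o p) /\ embeds_AAS X (EFin \o p) pm) /\
     (embeds_AAAS X pp (EFin \o p) /\ embeds_AAAS X (EFin \o p) pm)) /\
  (forall p q : R -> \bar R, var_exponent p -> var_exponent q ->
     {ae @leb R, forall x, itv01 x -> (p x <= q x)%E} ->
     embeds_AAS X q p /\ embeds_AAAS X q p).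
Proof.
split; [|split].
- move=> p [_ p1]; apply: embeds_le_exponent.
  by apply: aeW => x x01; split=> //=; exact: p1.
- move=> p [_ pm1 ae_p _] pm pp.
  have pm_p : le_exponent pm (EFin \o p).
    by apply: filterS ae_p => x + x01 => /(_ x01)/andP[].
  have p_pp : le_exponent (EFin \o p) pp.
    apply: filterS ae_p => x + x01 => /(_ x01)/andP[pmx pxp].
    by split=> //; exact: le_trans pmx.
  have [? ?] := embeds_le_exponent (X := X) pm_p.
  by have [? ?] := embeds_le_exponent (X := X) p_pp.
- move=> p q [_ p1] _ pq; apply: embeds_le_exponent.
  by apply: filterS pq => x + x01 => /(_ x01); split=> //; exact: p1.
Qed.
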